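(* A real Banach space $X$ is reflexive if and only if for every norm $\|\cdot\|'$ on $X$ equivalent to the given norm, the Banach space $(X,\|\cdot\|')$ is nicely smooth.
   Context: All Banach spaces are real. For a Banach space $X$, a set $A$ contained in the closed unit ball $B(X^* )$ of $X^*$ is a norming set for $X$ if $\|x\|=\sup\{x^*(x):x^*\in A\}$ for all $x\in X$. A closed subspace $F\subseteq X^*$ is a norming subspace if its closed unit ball $B(F)$ is a norming set for $X$. $X$ is nicely smooth if $X^*$ contains no proper norming (closed) subspace. *)

(* Defs.v *)
From HB Require Import structures.
From mathcomp Require Import all_boot all_order all_algebra.
From mathcomp Require Import all_classical all_reals all_analysis.

Set Implicit Arguments.
Unset Strict Implicit.
Unset Printing Implicit Defensive.

Import Order.TTheory GRing.Theory Num.Theory.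
Import numFieldNormedType.Exports.

Local Open Scope classical_set_scope.
Local Open Scope ring_scope.

Definition unit_ball {R : realType} (X : normedModType R) : set X :=
  [set x | `|x| <= 1].
Arguments unit_ball {R} X.

Definition dual_pred {R : realType} (X : normedModType R) : {pred X -> R} :=
  [pred f : X -> R | `[< linear f /\ continuous f >]].
Arguments dual_pred {R} X.

Record dual {R : realType} (X : normedModType R) := Dual {
  dual_fun :> X -> R ;
  dual_funP : dual_fun \in dual_pred X
}.

Section dual_lmodule.
Context {R : realType} {X : normedModType R}.

Lemma dual_predP (f : X -> R) : linear f -> continuous f -> f \in dual_pred X.
Proof. by move=> lf cf; rewrite inE. Qed.

Lemma dual_linear (f : dual X) : linear f.
Proof. by have := dual_funP f; rewrite inE => -[]. Qed.

Lemma dual_continuous (f : dual X) : continuous f.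
Proof. by have := dual_funP f; rewrite inE => -[]. Qed.

Lemma dual_submod : submod_closed (dual_pred X).
Proof.
split=> [|a f g].
  apply: dual_predP; last exact: cst_continuous.
  by move=> b x y; rewrite /= scaler0 addr0.
rewrite !inE => -[lf cf] [lg cg]; split.
  move=> b x y; 
  rewrite -[LHS]/(a *: f (b *: x + y) + g (b *: x + y)) lf lg.
  rewrite -[RHS]/(b *: (a *: f x + g x) + (a *: f y + g y)) !scalerDr.
  rewrite !scalerA (mulrC a b).
  by rewrite addrACA.
move=> x; apply: cvgD; last exact: cg.
by apply: cvgZr; exact: cf.
Qed.

HB.instance Definition _ := [isSub of dual X for @dual_fun R X].
HB.instance Definition _ := [Choice of dual X by <:].
HB.instance Definition _ :=
  GRing.isSubmodClosed.Build R (X -> R) (dual_pred X) dual_submod.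
HB.instance Definition _ := [SubChoice_isSubLmodule of dual X by <:].

HB.instance Definition _ (f : dual X) :=
  GRing.isLinear.Build R X R *:%R (dual_fun f) (dual_linear f).

Lemma dualDE (f g : dual X) x : (f + g) x = f x + g x.
Proof. by []. Qed.

Lemma dualZE (a : R) (f : dual X) x : (a *: f) x = a * f x.
Proof. by []. Qed.

Lemma dual0E x : (0 : dual X) x = 0.
Proof. by []. Qed.

Lemma dual_ext (f g : dual X) : (forall x, f x = g x) -> f = g.
Proof. by move=> fg; apply: val_inj; apply/funext. Qed.

End dual_lmodule.

Section dual_norm.
Context {R : realType} {X : normedModType R}.
Implicit Types f g : dual X.

Definition dual_norm f : R := sup [set `|f x| | x in unit_ball X].

Lemma dual_norm_has_sup f : has_sup [set `|f x| | x in unit_ball X].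
Proof.
split; first by exists `|f 0|, 0 => //; rewrite /unit_ball/= normr0.
have /linear_bounded_continuous/linear_boundedP := @dual_continuous R X f.
move=> /pinfty_ex_gt0[M M0 fM].
exists M => _ [x x1 <-]; rewrite (le_trans (fM x))//.
by rewrite ger_pMr.
Qed.

Lemma ler_dual_norm f x : `|f x| <= dual_norm f * `|x|.
Proof.
have [->|x0] := eqVneq x 0; first by rewrite linear0 !normr0 mulr0.
have nx0 : 0 < `|x| by rewrite normr_gt0.
rewrite -ler_pdivrMr//.
apply: ub_le_sup; first exact: (dual_norm_has_sup f).2.
exists (`|x|^-1 *: x).
  by rewrite /unit_ball/= normrZ normfV normr_id mulVf ?gt_eqF.
by rewrite linearZ/= normrZ normfV normr_id mulrC.
Qed.

Lemma dual_norm_le f M :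
  (forall x, `|x| <= 1 -> `|f x| <= M) -> dual_norm f <= M.
Proof.
move=> fM; apply: ge_sup; first exact: (dual_norm_has_sup f).1.
by move=> _ [x x1 <-]; exact: fM.
Qed.

Lemma ler_dual_norm1 f x : `|x| <= 1 -> `|f x| <= dual_norm f.
Proof.
by move=> x1; apply: ub_le_sup; [exact: (dual_norm_has_sup f).2|exists x].
Qed.

Lemma dual_normD f g : dual_norm (f + g) <= dual_norm f + dual_norm g.
Proof.
apply: dual_norm_le => x x1; rewrite dualDE (le_trans (ler_normD _ _))//.
by rewrite lerD// ler_dual_norm1.
Qed.

Lemma dual_normZ (a : R) f : dual_norm (a *: f) = `|a| * dual_norm f.
Proof.
have le_normZ b h : dual_norm (b *: h) <= `|b| * dual_norm h.
  apply: dual_norm_le => x x1.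
  by rewrite dualZE normrM ler_wpM2l// ler_dual_norm1.
apply/eqP; rewrite eq_le le_normZ/=.
have [->|a0] := eqVneq a 0.
  rewrite normr0 mul0r (le_trans (normr_ge0 ((0 *: f) 0)))//.
  by rewrite ler_dual_norm1// normr0.
rewrite -ler_pdivlMl ?normr_gt0// -normfV.
by rewrite -{1}(scale1r f) -(mulVf a0) -scalerA.
Qed.

Lemma dual_norm0_eq0 f : dual_norm f = 0 -> f = 0.
Proof.
move=> f0; apply: dual_ext => x; apply/eqP.
by rewrite dual0E -normr_le0 (le_trans (ler_dual_norm f x))// f0 mul0r.
Qed.

HB.instance Definition _ :=
  Lmodule_isNormed.Build R (dual X) dual_normD dual_normZ dual_norm0_eq0.

Lemma dual_normE f : `|f| = sup [set `|f x| | x in unit_ball X].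
Proof. by []. Qed.

End dual_norm.

Section evaluation.
Context {R : realType} {X : normedModType R}.

Lemma evaluation_subproof (x : X) :
  (fun f : dual X => f x) \in dual_pred (dual X).
Proof.
have le : linear (fun f : dual X => f x) by [].
apply: dual_predP => //.
pose e : {linear dual X -> R} :=
  HB.pack (fun f : dual X => f x) (GRing.isLinear.Build _ _ _ _ _ le).
apply: (@bounded_linear_continuous _ _ _ e); apply/linear_boundedP.
near=> r => f; rewrite (le_trans (ler_dual_norm f x))// mulrC
  ler_wpM2r ?(normr_ge0 f)//.
Unshelve. all: by end_near. Qed.

Definition evaluation (x : X) : dual (dual X) := Dual (evaluation_subproof x).

End evaluation.

Definition reflexive_space {R : realType} (X : completeNormedModType R)
    : Prop :=
  range (@evaluation R X) = setT.

Section nicely_smooth.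
Context {R : realType}.

(* The supremum is taken in [\bar R], so that it has no default value. *)
Definition norming_set {X : normedModType R} (A : set (dual X)) : Prop :=
  A `<=` unit_ball (dual X) /\
  forall x : X, (`|x|)%:E = ereal_sup [set (f x)%:E | f in A].

Definition closed_subspace {V : normedModType R} (F : set V) : Prop :=
  [/\ F 0, forall (a : R) u v, F u -> F v -> F (a *: u + v) & closed F].

Definition norming_subspace {X : normedModType R} (F : set (dual X)) : Prop :=
  closed_subspace F /\ norming_set (F `&` unit_ball (dual X)).

Definition nicely_smooth (X : completeNormedModType R) : Prop :=
  ~ exists F : set (dual X), norming_subspace F /\ F `<` setT.

End nicely_smooth.

Record equivalent_norm {R : realType} (X : normedModType R) := EquivalentNorm {
  enorm :> X -> R ;
  enormD : forall x y, enorm (x + y) <= enorm x + enorm y ;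
  enormZ : forall (a : R) x, enorm (a *: x) = `|a| * enorm x ;
  enorm0_eq0 : forall x, enorm x = 0 -> x = 0 ;
  enorm_equiv : exists c C : R, [/\ 0 < c, 0 < C &
    forall x, c * `|x| <= enorm x <= C * `|x|]
}.

(* An alias of the carrier of [X], with the linear structure of [X] and the
   norm [N]. *)
Definition renormed {R : realType} {X : normedModType R}
  (N : equivalent_norm X) : Type := X.

Section renormed_normedModule.
Context {R : realType} {X : normedModType R} (N : equivalent_norm X).

HB.instance Definition _ := GRing.Lmodule.copy (renormed N) X.
HB.instance Definition _ := Lmodule_isNormed.Build R (renormed N)
  (@enormD R X N) (@enormZ R X N) (@enorm0_eq0 R X N).

Lemma renormedE (x : X) : `|x : renormed N| = N x.
Proof. by []. Qed.

End renormed_normedModule.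

Section renormed_complete.
Context {R : realType} {X : completeNormedModType R} (N : equivalent_norm X).

Lemma renormed_cauchy_cvg (F : set_system (renormed N)) :
  ProperFilter F -> cauchy F -> cvg F.
Proof.
move=> FF /cauchy_ballP Fc.
have [c [C [c0 C0 cNC]]] := enorm_equiv N.
have : cvg (F : set_system X).
  apply: cauchy_cvg; apply/cauchy_ballP => e e0.
  have /Fc : 0 < c * e by rewrite mulr_gt0.
  apply: filterS => -[x y]; rewrite -!ball_normE /= => xy.
  rewrite -(ltr_pM2l c0); apply: le_lt_trans xy.
  by have /andP[] := cNC (x - y).
move=> /cvg_ex[l Fl]; apply/cvg_ex; exists (l : renormed N).
apply/cvgrPdist_lt => e e0.
have Ce : 0 < C^-1 * e by rewrite mulr_gt0// invr_gt0.
have := (@cvgrPdist_lt _ X _ F FF id l).1 Fl _ Ce.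
apply: filterS => y /= ly.
rewrite -(ltr_pM2l C0) mulrA divff ?gt_eqF// mul1r in ly.
by apply: le_lt_trans ly; have /andP[] := cNC (l - y).
Qed.

HB.instance Definition _ :=
  Uniform_isComplete.Build (renormed N) renormed_cauchy_cvg.

End renormed_complete.

(* Main.v *)
From HB Require Import structures.
Require Import Defs.
From mathcomp Require Import all_boot all_order all_algebra.
From mathcomp Require Import all_classical all_reals all_analysis.
From mathcomp Require Import ring.

(** Write J for the canonical embedding of X into its bidual.

    If X is reflexive, the dual of a renorming of X is the dual of X with an
    equivalent norm.  A proper closed subspace F of it is annihilated by some
    nonzero functional on the dual, by separation; reflexivity makes this
    functional the evaluation at a vector x, which is nonzero.  All of F
    vanishes at x, so F does not see the norm of x and is not norming
    ([reflexive_nicely_smooth]).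

    If X is not reflexive, pick phi in the bidual outside J(X).  The kernel of
    phi is a proper closed subspace of the dual, and it becomes norming if one
    renorms X by force, with N x the supremum of f x over the f in the unit ball
    of ker phi ([ker_norm]).  What must be shown is that N is equivalent to the
    given norm.  It is at most the given norm.  In the other direction, N x is
    the norm of the restriction of J x to ker phi; a norm-preserving extension
    of this restriction differs from J x by a multiple of phi, because both
    agree on ker phi, so |J x - t phi| <= N x for some t ([ker_norm_dist]).
    Completeness of X makes J(X) closed, hence phi lies at a distance d > 0 from
    it ([evaluation_dist_gt0]); this bounds |t| by N x / d, and then
    |x| <= |J x - t phi| + |t| |phi| <= (1 + |phi| / d) N x
    ([ler_norm_ker_norm]).

    Both halves rest on the Hahn-Banach theorem, which is proved first, by
    Zorn's lemma on graphs of partial functionals. *)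

Set Implicit Arguments.
Unset Strict Implicit.
Unset Printing Implicit Defensive.

Import Order.TTheory GRing.Theory Num.Theory.
Import numFieldNormedType.Exports.

Local Open Scope classical_set_scope.
Local Open Scope ring_scope.

(** * The Hahn-Banach theorem *)

Section hahn_banach.
Context {R : realType} {V : lmodType R} (p : V -> R).

(** A partial linear functional below [p], encoded as a linear subspace of
    [V * R], so that neither domains nor dependent types are needed and unions
    of chains are plain unions.  Single-valuedness is a consequence of the
    domination, see [dominated_graph_fun]. *)
Definition dominated_graph (G : set (V * R)) : Prop :=
  [/\ G (0, 0),
      forall (a : R) x r y s, G (x, r) -> G (y, s) -> G (a *: x + y, a * r + s)
    & forall x r, G (x, r) -> r <= p x].

Hypothesis pD : forall x y, p (x + y) <= p x + p y.
Hypothesis pZ : forall (t : R) x, 0 <= t -> p (t *: x) = t * p x.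

(** The difference of two pairs over the same point is a pair over 0, and there
    [p] vanishes. *)
Lemma dominated_graph_fun G : dominated_graph G ->
  forall x r s, G (x, r) -> G (x, s) -> r = s.
Proof.
move=> [G0 Glin Gp].
have p0 : p 0 = 0 by rewrite -(scale0r (0 : V)) pZ// mul0r.
suff le x r s : G (x, r) -> G (x, s) -> r <= s.
  by move=> x r s Gr Gs; apply/eqP; rewrite eq_le (le x)// (le x).
move=> Gr Gs; rewrite -subr_le0 -p0.
have := Gp _ _ (Glin (-1) _ _ _ _ Gs Gr).
by rewrite scaleN1r addNr mulN1r addrC.
Qed.

(** One-dimensional extension.  By homogeneity the value [c] at [v] only has to
    satisfy [r + c <= p (x + v)] and [r - c <= p (x - v)] on the graph; by
    subadditivity every lower bound [r - p (x - v)] is below every upper bound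
    [p (x + v) - r], so the supremum of the lower bounds will do. *)
Lemma dominated_graph_step G v : dominated_graph G ->
  exists c : R, dominated_graph
    [set z | exists x r t, G (x, r) /\ z = (x + t *: v, r + t * c)].
Proof.
move=> [G0 Glin Gp].
pose L := [set z.2 - p (z.1 - v) | z in G].
have Lub x r : G (x, r) -> ubound L (p (x + v) - r).
  move=> Gx _ [[y s] Gy <-] /=; rewrite lerBrDr addrAC lerBlDr.
  have /Gp := Glin 1 _ _ _ _ Gx Gy; rewrite scale1r mul1r addrC.
  move=> /le_trans; apply; apply: le_trans (pD _ _).
  by rewrite addrACA subrr addr0.
have L0 : L !=set0 by exists (0 - p (0 - v)), (0, 0).
exists (sup L); set c := sup L.
have cle x r : G (x, r) -> r + c <= p (x + v).
  by move=> Gx; rewrite addrC -lerBrDr; apply: ge_sup => //; exact: Lub.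
have cge x r : G (x, r) -> r - c <= p (x - v).
  move=> Gx; rewrite lerBlDr -lerBlDl; apply: ub_le_sup.
    by exists (p (0 + v) - 0); exact: Lub.
  by exists (x, r).
have GZ a x r : G (x, r) -> G (a *: x, a * r).
  by move=> Gx; have := Glin a _ _ _ _ Gx G0; rewrite !addr0.
split.
- by exists 0, 0, 0; rewrite scale0r mul0r !addr0.
- move=> a _ _ _ _ [x [r [t [Gx [-> ->]]]]] [y [s [t' [Gy [-> ->]]]]].
  exists (a *: x + y), (a * r + s), (a * t + t'); split; first exact: Glin.
  by congr pair; [rewrite scalerDr scalerDl scalerA addrACA|ring].
- move=> _ _ [x [r [t [Gx [-> ->]]]]].
  have [t0|t0|->] := ltgtP t 0; last by rewrite scale0r mul0r !addr0; exact: Gp.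
  + have nt0 : 0 < - t by rewrite oppr_gt0.
    have := ler_wpM2l (ltW nt0) (cge _ _ (GZ (- t)^-1 _ _ Gx)).
    rewrite -(pZ _ (ltW nt0)) mulrBr scalerBr scalerA mulrA.
    by rewrite mulfV ?gt_eqF// mul1r scale1r mulNr scaleNr !opprK.
  + have := ler_wpM2l (ltW t0) (cle _ _ (GZ t^-1 _ _ Gx)).
    rewrite -(pZ _ (ltW t0)) mulrDr scalerDr scalerA mulrA.
    by rewrite mulfV ?gt_eqF// mul1r scale1r.
Qed.

(** Zorn's lemma for the dominated graphs that contain [G].  The property given
    to Zorn's lemma is that of [A `|` G], since it must also hold for the union
    of the empty chain. *)
Lemma dominated_graph_maximal G : dominated_graph G ->
  exists2 M, dominated_graph M /\ G `<=` M &
    forall B, dominated_graph B -> M `<=` B -> B `<=` M.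
Proof.
move=> dG; have [G0 Glin Gp] := dG.
have [|A [dA Amax]] := @Zorn_bigcup _ [set A | dominated_graph (A `|` G)].
  move=> F FP Ftot.
  have [->|/set0P[A0 FA0]] := eqVneq F set0.
    by rewrite /= bigcup_set0 set0U.
  split; first by right.
    have key A : F A -> (A `|` G) `<=` (\bigcup_(X in F) X `|` G).
      by move=> FA z [Az|Gz]; [left; exists A|right].
    have pick z : (\bigcup_(X in F) X `|` G) z -> exists2 A, F A & (A `|` G) z.
      by move=> [[A FA Az]|Gz]; [exists A => //; left|exists A0 => //; right].
    move=> a x r y s /pick[A FA Ax] /pick[B FB By].
    have [AB|BA] := Ftot _ _ FA FB.
      apply: (key _ FB); have [_ + _] := FP _ FB; apply => //.
      by case: Ax => [/AB|]; [left|right].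
    apply: (key _ FA); have [_ + _] := FP _ FA; apply => //.
    by case: By => [/BA|]; [left|right].
  by move=> x r [[A FA Ax]|]; [have [_ _] := FP _ FA; apply; left|exact: Gp].
exists (A `|` G); first by split=> // z; right.
move=> B dB AGB; apply: contrapT => BAG; apply: (Amax B).
  split=> [z Az|BA]; first by apply: AGB; left.
  by apply: BAG => z /BA; left.
by rewrite /= setUidl// => z Gz; apply: AGB; right.
Qed.

Theorem hahn_banach G : dominated_graph G ->
  exists f : V -> R, [/\ linear f, forall x, f x <= p x
    & forall x r, G (x, r) -> f x = r].
Proof.
move=> /dominated_graph_maximal[M [dM GM] Mmax].
have dom x : exists r, M (x, r).
  (* A one-dimensional extension of the maximal graph stays inside it. *)
  have [c dB] := dominated_graph_step x dM.
  exists c; apply: (Mmax _ dB).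
    by move=> [y r] My; exists y, r, 0; rewrite scale0r mul0r !addr0.
  have [M0 _ _] := dM.
  by exists 0, 0, 1; rewrite scale1r mul1r !add0r.
have [f Mf] := choice dom; have [M0 Mlin Mp] := dM.
exists f; split=> [a x y|x|x r /GM Mx].
- by apply: (dominated_graph_fun dM (Mf _)); exact: Mlin.
- exact: Mp.
- exact: (dominated_graph_fun dM (Mf _)).
Qed.

End hahn_banach.

(** * Bounded functionals on a normed space *)

Section bounded_functionals.
Context {R : realType}.
Implicit Types X : normedModType R.

Lemma bounded_dual_pred X (f : X -> R) (k : R) :
  linear f -> (forall x, `|f x| <= k * `|x|) -> f \in dual_pred X.
Proof.
move=> lf fk; apply: dual_predP => //.
pose e : {linear X -> R} := HB.pack f (GRing.isLinear.Build _ _ _ _ _ lf).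
apply: (@bounded_linear_continuous _ _ _ e); apply/linear_boundedP.
near=> r => x; apply: le_trans (fk x) _; rewrite ler_wpM2r//.
Unshelve. all: by end_near. Qed.

Lemma dual_norm_le_bound X (f : dual X) (k : R) : 0 <= k ->
  (forall x, `|f x| <= k * `|x|) -> `|f| <= k.
Proof.
move=> k0 fk; apply: dual_norm_le => x x1; apply: le_trans (fk x) _.
by rewrite ler_piMr.
Qed.

Lemma hahn_banach_bounded X (k : R) (G : set (X * R)) : 0 <= k ->
  dominated_graph (fun x => k * `|x|) G ->
  exists2 f : dual X, `|f| <= k & forall x r, G (x, r) -> f x = r.
Proof.
move=> k0 dG; have [x y|t x t0|f [lf fp fG]] := hahn_banach _ _ dG.
- by rewrite -mulrDr ler_wpM2l// ler_normD.
- by rewrite normrZ ger0_norm// mulrCA.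
have fk x : `|f x| <= k * `|x|.
  rewrite ler_norml fp andbT lerNl -(normrN x).
  suff -> : - f x = f (- x) by exact: fp.
  have f0 : f 0 = 0.
    by have := lf (-1) 0 0; rewrite scaler0 addr0 scaleN1r addNr.
  by have := lf (-1) x 0; rewrite addr0 f0 addr0 !scaleN1r.
exists (Dual (bounded_dual_pred lf fk)) => //.
exact: dual_norm_le_bound.
Qed.

Lemma exists_norming_functional X (x : X) :
  exists2 f : dual X, `|f| <= 1 & f x = `|x|.
Proof.
have [|f f1 fG] := @hahn_banach_bounded X 1
    [set z | exists t, z = (t *: x, t * `|x|)] ler01.
  split.
  - by exists 0; rewrite scale0r mul0r.
  - move=> a _ _ _ _ [t [-> ->]] [s [-> ->]]; exists (a * t + s).
    by rewrite scalerA -scalerDl mulrA -mulrDl.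
  - move=> _ _ [t [-> ->]]; rewrite mul1r normrZ.
    by rewrite ler_wpM2r// ler_norm.
by exists f => //; apply: fG; exists 1; rewrite scale1r mul1r.
Qed.

Lemma normr_evaluation X (x : X) : `|evaluation x| = `|x|.
Proof.
apply/eqP; rewrite eq_le; apply/andP; split.
  apply: dual_norm_le_bound => // f; rewrite mulrC.
  exact: (ler_dual_norm f x).
have [f f1 fx] := exists_norming_functional x.
rewrite -fx; apply: le_trans (ler_norm _) _.
exact: (@ler_dual_norm1 _ _ (evaluation x) f f1).
Qed.

(** Extension of [t *: v + y |-> t], for [y] in [F], whose norm is at most
    [d^-1] because [v] lies at distance at least [d] from [F]. *)
Lemma exists_separating_functional X (F : set X) (v : X) (d : R) :
  F 0 -> (forall (a : R) x y, F x -> F y -> F (a *: x + y)) ->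
  0 < d -> (forall y, F y -> d <= `|v - y|) ->
  exists2 f : dual X, f v = 1 & forall y, F y -> f y = 0.
Proof.
move=> F0 Flin d0 Fd.
have FN y : F y -> F (- y).
  by move=> Fy; rewrite -scaleN1r -[_ *: _]addr0; exact: Flin.
have [||f f1 fG] := @hahn_banach_bounded X d^-1
    [set z | exists t y, F y /\ z = (t *: v + y, t)].
- by rewrite invr_ge0 ltW.
- split.
  + by exists 0, 0; split=> //; rewrite scale0r addr0.
  + move=> a _ _ _ _ [t [y [Fy [-> ->]]]] [s [z [Fz [-> ->]]]].
    exists (a * t + s), (a *: y + z); split; first exact: Flin.
    by rewrite scalerDr scalerA scalerDl addrACA.
  + move=> _ _ [t [y [Fy [-> ->]]]]; rewrite ler_pdivlMl//.
    have [t0|t0] := leP t 0.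
      by apply: le_trans (normr_ge0 _); rewrite mulr_ge0_le0// ltW.
    have -> : t *: v + y = t *: (v - - (t^-1 *: y)).
      by rewrite opprK scalerDr scalerA mulfV ?gt_eqF// scale1r.
    rewrite normrZ gtr0_norm// mulrC ler_pM2l//; apply/Fd/FN.
    by rewrite -[_ *: _]addr0; exact: Flin.
exists f; first by apply: fG; exists 1, 0; rewrite scale1r addr0.
by move=> y Fy; apply: fG; exists 0, y; rewrite scale0r add0r.
Qed.

Lemma closed_dist_gt0 X (F : set X) v : closed F -> ~ F v ->
  exists2 d : R, 0 < d & forall y, F y -> d <= `|v - y|.
Proof.
move=> cF Fv; have : nbhs v (~` F).
  by apply: open_nbhs_nbhs; split => //; exact: closed_openC.
move=> /nbhs_ballP[d /= d0 dF]; exists d => // y Fy.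
rewrite leNgt; apply/negP => vy; apply: (dF y) => //.
by rewrite -ball_normE.
Qed.

End bounded_functionals.

(** * The image of the canonical embedding is closed *)

Section evaluation_range.
Context {R : realType} (X : completeNormedModType R).

(** The embedding is isometric and X is complete: if the distance were 0, the
    sets of points whose image is within [e] of [phi] would form a base of a
    Cauchy filter, and [phi] would be the image of its limit. *)
Lemma evaluation_dist_gt0 (phi : dual (dual X)) :
  ~ range (@evaluation R X) phi ->
  exists2 d : R, 0 < d & forall x, d <= `|phi - evaluation x|.
Proof.
move=> nphi; apply: contrapT => nd.
have near_phi e : 0 < e -> exists x, `|phi - evaluation x| < e.
  move=> e0; apply: contrapT => ne; apply: nd; exists e => // x.
  by rewrite leNgt; apply/negP => xe; apply: ne; exists x.
have evB x y :
    evaluation (x - y) = evaluation x - evaluation y :> dual (dual X).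
  by apply: dual_ext => f; exact: linearB.
pose B (e : R) := [set x : X | `|phi - evaluation x| < e].
pose F := filter_from [set e : R | 0 < e] B.
have FF : ProperFilter F.
  apply: filter_from_proper; last first.
    by move=> e /= /near_phi[x xe]; exists x.
  apply: filter_from_filter; first by exists 1 => /=.
  move=> e e' /= e0 e'0; exists (Num.min e e'); first by rewrite /= lt_min e0.
  by move=> x; rewrite /B /= lt_min => /andP[].
have FB e : 0 < e -> F (B e) by exists e.
have : cvg F.
  apply: cauchy_cvg; apply/cauchy_ballP => e e0.
  have e20 : 0 < e / 2 by rewrite divr_gt0.
  exists (B (e / 2), B (e / 2)); first by split; exact: FB.
  move=> [x y] [/= Bx By]; rewrite -ball_normE /= -normr_evaluation evB.
  rewrite (le_lt_trans (ler_distD phi _ _))// [ltRHS]splitr ltrD//.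
  by rewrite distrC.
move=> /cvg_ex[l Fl]; apply: nphi; exists l => //.
apply/eqP; rewrite eq_sym -subr_eq0 -normr_le0; apply/ler_addgt0Pl => e e0.
rewrite addr0.
have e20 : 0 < e / 2 by rewrite divr_gt0.
have /cvgrPdist_lt/(_ _ e20) Fe : id @ F --> l by exact: Fl.
have [x [xe lx]] := filter_ex (filterI (FB _ e20) Fe).
rewrite (le_trans (ler_distD (evaluation x) _ _))// [leRHS]splitr.
by rewrite lerD ?(ltW xe)// -evB normr_evaluation distrC ltW.
Qed.

End evaluation_range.

(** * The dual under an equivalent norm *)

Section renormed_dual.
Context {R : realType} {X : normedModType R} (N : equivalent_norm X).

Lemma renorm_dual_subproof (f : dual X) :
  (f : renormed N -> R) \in dual_pred (renormed N).
Proof.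
have [c [C [c0 _ cNC]]] := enorm_equiv N.
apply: (@bounded_dual_pred _ _ _ (`|f| / c)) => [|x].
  exact: (@dual_linear _ X f).
apply: le_trans (ler_dual_norm f x) _.
rewrite -mulrA ler_wpM2l ?(normr_ge0 f)// ler_pdivlMl//.
by have /andP[] := cNC x.
Qed.

Definition renorm_dual (f : dual X) : dual (renormed N) :=
  Dual (renorm_dual_subproof f).

Lemma unrenorm_dual_subproof (g : dual (renormed N)) :
  (g : X -> R) \in dual_pred X.
Proof.
have [c [C [_ C0 cNC]]] := enorm_equiv N.
apply: (@bounded_dual_pred _ _ _ (`|g| * C)) => [|x].
  exact: (@dual_linear _ (renormed N) g).
apply: le_trans (ler_dual_norm g x) _.
rewrite -mulrA ler_wpM2l ?(normr_ge0 g)//.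
by have /andP[] := cNC x.
Qed.

Definition unrenorm_dual (g : dual (renormed N)) : dual X :=
  Dual (unrenorm_dual_subproof g).

Lemma renorm_dual_linear : linear renorm_dual.
Proof. by move=> a f g; exact: dual_ext. Qed.

Lemma unrenorm_dual_linear : linear unrenorm_dual.
Proof. by move=> a f g; exact: dual_ext. Qed.

Lemma renorm_dualK : cancel renorm_dual unrenorm_dual.
Proof. by move=> f; exact: dual_ext. Qed.

Lemma unrenorm_dualK : cancel unrenorm_dual renorm_dual.
Proof. by move=> g; exact: dual_ext. Qed.

Lemma renorm_dual_bounded : exists2 k : R, 0 < k &
  forall f, `|renorm_dual f| <= k * `|f|.
Proof.
have [c [C [c0 _ cNC]]] := enorm_equiv N.
exists c^-1 => [|f]; first by rewrite invr_gt0.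
apply: dual_norm_le_bound => [|x].
  by rewrite mulr_ge0// invr_ge0 ltW.
apply: le_trans (ler_dual_norm f x) _.
rewrite -mulrA mulrCA ler_wpM2l ?(normr_ge0 f)// ler_pdivlMl//.
by have /andP[] := cNC x.
Qed.

Lemma unrenorm_dual_bounded : exists2 k : R, 0 < k &
  forall g, `|unrenorm_dual g| <= k * `|g|.
Proof.
have [c [C [_ C0 cNC]]] := enorm_equiv N.
exists C => // g; apply: dual_norm_le_bound => [|x].
  by rewrite mulr_ge0// ltW.
apply: le_trans (ler_dual_norm g x) _.
rewrite -mulrA mulrCA ler_wpM2l ?(normr_ge0 g)//.
by have /andP[] := cNC x.
Qed.

End renormed_dual.

(** * Reflexive spaces are nicely smooth under every renorming *)

Section nicely_smooth_of_reflexive.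
Context {R : realType} (X : completeNormedModType R).

(** The separation takes place in the dual of X, where reflexivity of X applies
    directly; [F] is transported there, and the distance to [F] survives up to
    a constant, so reflexivity never has to be transported to the renormed
    space. *)
Lemma reflexive_nicely_smooth (N : equivalent_norm X) :
  reflexive_space X -> nicely_smooth (renormed N).
Proof.
move=> reflX [F [[[F0 Flin Fcl] [_ Fnorming]] [_ nF]]].
have [g0 Fg0] : exists g, ~ F g by apply/existsNP => FT; apply: nF => g _.
have [d d0 Fd] := closed_dist_gt0 Fcl Fg0.
have [k k0 kN] := renorm_dual_bounded N.
have [||||phi phi_g0 phi_F] := @exists_separating_functional _ (dual X)
    [set f | F (renorm_dual N f)] (unrenorm_dual g0) (d / k).
- by rewrite /= (_ : renorm_dual N 0 = 0)//; exact: dual_ext.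
- move=> a f g /= Ff Fg.
  by rewrite renorm_dual_linear; exact: Flin.
- by rewrite divr_gt0.
- move=> f /= Ff; rewrite ler_pdivrMr// mulrC.
  apply: le_trans (kN _); apply: le_trans (Fd _ Ff) _.
  have -> // : g0 - renorm_dual N f = renorm_dual N (unrenorm_dual g0 - f).
  exact: dual_ext.
have [x _ xphi] : range (@evaluation R X) phi by rewrite reflX.
have x0 : x = 0.
  apply: (@enorm0_eq0 _ _ N); apply/eqP; rewrite -[N x]/(`|x : renormed N|).
  rewrite -normr_le0 normr_id -lee_fin Fnorming.
  apply: ge_ereal_sup => _ [g [Fg _] <-].
  have := phi_F (unrenorm_dual g); rewrite -xphi => gx0.
  rewrite lee_fin -[g x]/(evaluation x (unrenorm_dual g)) gx0//=.
  by rewrite /= unrenorm_dualK.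
have /eqP := phi_g0; rewrite -xphi x0.
by rewrite -[X in X == _]/(unrenorm_dual g0 0) linear0 eq_sym oner_eq0.
Qed.

End nicely_smooth_of_reflexive.

(** * A renorming for which the kernel of a functional is norming *)

Section renorming.
Context {R : realType} (X : completeNormedModType R) (phi : dual (dual X)).

Definition ker_ball : set (dual X) := [set f | phi f = 0 /\ `|f| <= 1].

Definition ker_norm (x : X) : R := sup [set f x | f in ker_ball].

Let ker_ball0 : ker_ball 0.
Proof. by split; [exact: linear0|rewrite normr0]. Qed.

Lemma ker_norm_has_sup x : has_sup [set f x | f in ker_ball].
Proof.
split; first by exists 0, 0.
exists `|x| => _ [f [_ f1] <-].
apply: le_trans (ler_norm _) _; apply: le_trans (ler_dual_norm f x) _.
by rewrite ler_piMl.
Qed.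

Lemma ler_ker_norm f x : ker_ball f -> f x <= ker_norm x.
Proof.
by move=> kf; apply: ub_le_sup; [exact: (ker_norm_has_sup x).2|exists f].
Qed.

Lemma ker_norm_le x k : (forall f, ker_ball f -> f x <= k) -> ker_norm x <= k.
Proof.
move=> fk; apply: ge_sup; first exact: (ker_norm_has_sup x).1.
by move=> _ [f kf <-]; exact: fk.
Qed.

Lemma ker_norm_ge0 x : 0 <= ker_norm x.
Proof. exact: (ler_ker_norm x ker_ball0). Qed.

Lemma ker_norm_le_norm x : ker_norm x <= `|x|.
Proof.
apply: ker_norm_le => f [_ f1]; apply: le_trans (ler_norm _) _.
by apply: le_trans (ler_dual_norm f x) _; rewrite ler_piMl.
Qed.

Lemma ker_normD x y : ker_norm (x + y) <= ker_norm x + ker_norm y.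
Proof.
by apply: ker_norm_le => f kf; rewrite linearD lerD// ler_ker_norm.
Qed.

Lemma ker_normZ (a : R) x : ker_norm (a *: x) = `|a| * ker_norm x.
Proof.
have leZ b y : ker_norm (b *: y) <= `|b| * ker_norm y.
  apply: ker_norm_le => f [pf f1]; rewrite linearZ/= -[_ *: _]/(b * f y).
  have [b0|b0] := leP 0 b.
    by rewrite (ger0_norm b0) ler_wpM2l// ler_ker_norm.
  rewrite (ltr0_norm b0) -[leLHS]mulrNN ler_wpM2l ?oppr_ge0 ?(ltW b0)//.
  apply: (@ler_ker_norm (- f)); split; last by rewrite normrN.
  by rewrite linearN/= pf oppr0.
apply/eqP; rewrite eq_le leZ/=.
have [->|a0] := eqVneq a 0; first by rewrite normr0 mul0r ker_norm_ge0.
rewrite -ler_pdivlMl ?normr_gt0// -normfV.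
by rewrite -{1}(scale1r x) -(mulVf a0) -scalerA.
Qed.

(** The norm of the restriction of [evaluation x] to the kernel of [phi] is the
    distance from [evaluation x] to the annihilator of this kernel, which is the
    line spanned by [phi]. *)
Lemma ker_norm_dist x : exists t : R, `|evaluation x - t *: phi| <= ker_norm x.
Proof.
have kf f : phi f = 0 -> f x <= ker_norm x * `|f|.
  move=> pf; have [->|f0] := eqVneq f 0; first by rewrite normr0 mulr0.
  have nf0 : 0 < `|f| by rewrite normr_gt0.
  rewrite mulrC -ler_pdivrMl//.
  apply: (@ler_ker_norm (`|f|^-1 *: f)); split.
    by rewrite linearZ/= pf scaler0.
  by rewrite normrZ normfV normr_id mulVf ?gt_eqF.
have [|psi psi_le psiG] := @hahn_banach_bounded _ (dual X) (ker_norm x)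
    [set z | phi z.1 = 0 /\ z.2 = z.1 x] (ker_norm_ge0 x).
  split=> [|a f r g s [/= pf ->] [/= pg ->]|f r [/= pf ->]].
  - by split=> //; exact: linear0.
  - by split => //=; rewrite linearP/= pf pg scaler0 addr0.
  - exact: kf.
have psi_ker f : phi f = 0 -> psi f = f x by move=> pf; exact: psiG.
have [phi0|/existsNP[f0 /eqP pf0]] := pselect (forall f, phi f = 0).
  exists 0; rewrite scale0r subr0.
  by have -> : evaluation x = psi by apply: dual_ext => f; rewrite psi_ker.
(* [evaluation x - psi] vanishes on the kernel of [phi], hence is the multiple
   of [phi] that has the right value at [f0]. *)
exists ((f0 x - psi f0) / phi f0).
suff -> : evaluation x - ((f0 x - psi f0) / phi f0) *: phi = psi by [].
apply: dual_ext => f.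
have := psi_ker (f - (phi f / phi f0) *: f0).
rewrite linearB linearZ/= -[_ *: _]/(phi f / phi f0 * phi f0) mulfVK// subrr.
move=> /(_ erefl).
rewrite linearB linearZ/= => psif.
change (f x - (f0 x - psi f0) / phi f0 * phi f = psi f).
move/eqP: psif; rewrite subr_eq => /eqP ->.
change (f x - (f0 x - psi f0) / phi f0 * phi f =
  f x - phi f / phi f0 * f0 x + phi f / phi f0 * psi f0).
by field.
Qed.

(** The multiple [t] of [phi] given by [ker_norm_dist] is controlled by the
    distance [d] from [phi] to the image of X: dividing by [t] gives
    [`|t| * d <= ker_norm x], and the triangle inequality concludes. *)
Lemma ler_norm_ker_norm : ~ range (@evaluation R X) phi ->
  exists2 c : R, 0 < c & forall x, c * `|x| <= ker_norm x.
Proof.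
move=> /evaluation_dist_gt0[d d0 dphi].
exists (1 + `|phi| / d)^-1 => [|x].
  by rewrite invr_gt0 ltr_pwDl// divr_ge0// ltW.
rewrite ler_pdivrMl; last by rewrite ltr_pwDl// divr_ge0// ltW.
have [t tx] := ker_norm_dist x.
have td : `|t| * d <= ker_norm x.
  have [->|t0] := eqVneq t 0; first by rewrite normr0 mul0r ker_norm_ge0.
  apply: le_trans tx.
  have -> : evaluation x - t *: phi = - t *: (phi - evaluation (t^-1 *: x)).
    apply: dual_ext => f.
    have fZ : f (t^-1 *: x) = t^-1 * f x by exact: linearZ.
    change (f x - t * phi f = - t * (phi f - f (t^-1 *: x))).
    by rewrite fZ; field.
  by rewrite normrZ normrN ler_wpM2l.
rewrite -normr_evaluation -[evaluation x](subrK (t *: phi)).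
apply: le_trans (ler_normD _ _) _; rewrite mulrDl mul1r lerD// normrZ.
by rewrite mulrC -mulrA ler_wpM2l// ler_pdivlMl// mulrC.
Qed.

Section ker_equivalent_norm.
Hypothesis nphi : ~ range (@evaluation R X) phi.

Lemma ker_norm0_eq0 x : ker_norm x = 0 -> x = 0.
Proof.
have [c c0 cx] := ler_norm_ker_norm nphi.
move=> x0; apply/eqP; rewrite -normr_le0 -(ler_pM2l c0) mulr0 -x0.
exact: cx.
Qed.

Lemma ker_norm_equiv : exists c C : R, [/\ 0 < c, 0 < C &
  forall x, c * `|x| <= ker_norm x <= C * `|x|].
Proof.
have [c c0 cx] := ler_norm_ker_norm nphi.
by exists c, 1; split=> // x; rewrite cx mul1r ker_norm_le_norm.
Qed.

Definition ker_equivalent_norm : equivalent_norm X :=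
  EquivalentNorm ker_normD ker_normZ ker_norm0_eq0 ker_norm_equiv.

(** The kernel of [phi], transported to the dual of the renormed space, is the
    norming subspace.  It is norming because the unit ball of the kernel for the
    old norm lies in the one for the new norm, by definition of the new norm. *)
Lemma ker_equivalent_norm_not_nicely_smooth :
  ~ nicely_smooth (renormed ker_equivalent_norm).
Proof.
set N := ker_equivalent_norm; apply.
pose psi (g : dual (renormed N)) : R := phi (unrenorm_dual g).
have lin_psi : linear psi.
  by move=> a f g; rewrite /psi unrenorm_dual_linear linearP.
have [k k0 kN] := unrenorm_dual_bounded N.
have psi_le g : `|psi g| <= `|phi| * k * `|g|.
  apply: le_trans (ler_dual_norm phi _) _.
  by rewrite -mulrA ler_wpM2l ?(normr_ge0 phi).
have psi_cont : continuous psi.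
  exact: (@dual_continuous _ _ (Dual (bounded_dual_pred lin_psi psi_le))).
have psi0 : psi 0 = 0.
  by have := lin_psi (-1) 0 0; rewrite scaler0 addr0 scaleN1r addNr.
exists [set g | psi g = 0]; split; first split.
- split=> //.
  + by move=> a f g /= pf pg; rewrite lin_psi pf pg scaler0 addr0.
  + apply: (@preimage_closed _ _ psi [set 0]); last exact: closed_eq.
    by move=> g _; exact: psi_cont.
- split=> [g []//|x].
  apply/eqP; rewrite eq_le; apply/andP; split.
    rewrite -[(`|x|)%:E]/((sup [set f x | f in ker_ball])%:E).
    have [? ?] := ker_norm_has_sup x.
    rewrite -ereal_sup_EFin//; apply: le_ereal_sup => _ [_ [f [pf f1] <-] <-].
    exists (renorm_dual N f) => //; split.
      by rewrite /= /psi renorm_dualK.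
    apply: dual_norm_le_bound => // y; rewrite mul1r ler_norml.
    apply/andP; split.
      rewrite lerNl; apply: (@ler_ker_norm (- f) y).
      by split; [rewrite linearN/= pf oppr0|rewrite normrN].
    exact: (@ler_ker_norm f y).
  apply: ge_ereal_sup => _ [g [_ g1] <-]; rewrite lee_fin.
  apply: le_trans (ler_norm _) _; apply: le_trans (ler_dual_norm g x) _.
  by rewrite ler_piMl.
- split=> // sub; apply: nphi; exists 0 => //; apply: dual_ext => f.
  have := sub (renorm_dual N f) Logic.I.
  rewrite /= /psi renorm_dualK => pf; change (f 0 = phi f).
  by rewrite linear0.
Qed.

End ker_equivalent_norm.
End renorming.

Theorem theorem9 (R : realType) (X : completeNormedModType R) :
  reflexive_space X <->
  forall N : equivalent_norm X, nicely_smooth (renormed N).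
Proof.
split=> [reflX N|smoothX]; first exact: reflexive_nicely_smooth.
apply/seteqP; split=> // phi _; apply: contrapT => nphi.
apply: (@ker_equivalent_norm_not_nicely_smooth _ _ _ nphi).
exact: smoothX.
Qed.
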